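(* Let $\phi:[0,\infty)\times E_k\to E_k$ be a solution of a generalised system. Then for every $\eta\in E_k$ the limit set of $\phi(t,\eta)/t$, for $t\to+\infty$, coincides with $Q(\eta)$.
   Context: $E_k$ ($k\ge1$) denotes the space $\mathbb{R}^k$ with norm $\|X\|=\max_{1\le p\le k}|x_p|$. A solution of a generalised system is a (jointly) continuous function $\phi:[0,\infty)\times E_k\to E_k$ such that, with $\psi(\eta)=\phi(1,\eta)$, one has $\phi(0,\eta)=\eta$, $\phi(t,\eta+q)=\phi(t,\eta)+q$, $\psi(\eta+q)=\psi(\eta)+q$ and $\phi(t+1,\eta)=\phi(t,\psi(\eta))$ for all $t\ge0$, $\eta\in E_k$, $q\in\mathbb{Z}^k$. Put $\psi_0(\eta)=\eta$, $\psi_n(\eta)=\psi(\psi_{n-1}(\eta))$ for $n\ge1$, $a(\eta)=\psi(\eta)-\eta$, and $a_n(\eta)=a(\eta)+a(\psi(\eta))+\dots+a(\psi_{n-1}(\eta))$ for $n\ge 1$. The limit set of a sequence $B_n$ ($n\in\mathbb{N}$), respectively of a family $B_t$ ($t\in(0,\infty)$), is the set of all vectors $\gamma$ for which there are $n_p\in\mathbb{N}$, $n_p\to\infty$, with $\gamma=\lim B_{n_p}$, respectively $t_p\in(0,\infty)$, $t_p\to\infty$, with $\gamma=\lim B_{t_p}$. $Q(\eta)$ denotes the limit set of the sequence $a_n(\eta)/n$. *)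

(* Defs.v *)
From mathcomp Require Import all_boot all_order all_algebra.
From mathcomp Require Import all_classical all_reals all_analysis.

Set Implicit Arguments.
Unset Strict Implicit.
Unset Printing Implicit Defensive.

Import Order.TTheory GRing.Theory Num.Theory.
Import numFieldNormedType.Exports.

Local Open Scope classical_set_scope.
Local Open Scope ring_scope.

(* The norm of the library on 'rV[R]_k is the maximum norm. *)

Definition int_vec (R : realType) (k : nat) (q : 'rV[int]_k) : 'rV[R]_k :=
  map_mx intr q.

Definition psi (R : realType) (k : nat) (phi : R -> 'rV[R]_k -> 'rV[R]_k)
  (eta : 'rV[R]_k) : 'rV[R]_k := phi 1 eta.

(* A map on [0, +oo[ * E_k is represented by a total function of t : R;
   nothing is required of its values at t < 0. *)
Definition generalised_solution (R : realType) (k : nat)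
    (phi : R -> 'rV[R]_k -> 'rV[R]_k) : Prop :=
  [/\ {within [set p : R * 'rV[R]_k | 0 <= p.1],
        continuous (fun p : R * 'rV[R]_k => phi p.1 p.2)},
      forall eta, phi 0 eta = eta,
      forall t eta (q : 'rV[int]_k), 0 <= t ->
        phi t (eta + int_vec R q) = phi t eta + int_vec R q,
      forall eta (q : 'rV[int]_k),
        psi phi (eta + int_vec R q) = psi phi eta + int_vec R q
    & forall t eta, 0 <= t -> phi (t + 1) eta = phi t (psi phi eta)].

Definition psi_iter (R : realType) (k : nat)
  (phi : R -> 'rV[R]_k -> 'rV[R]_k) (n : nat) (eta : 'rV[R]_k) : 'rV[R]_k :=
  iter n (psi phi) eta.

Definition a (R : realType) (k : nat) (phi : R -> 'rV[R]_k -> 'rV[R]_k)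
  (eta : 'rV[R]_k) : 'rV[R]_k := psi phi eta - eta.

Definition a_sum (R : realType) (k : nat) (phi : R -> 'rV[R]_k -> 'rV[R]_k)
  (n : nat) (eta : 'rV[R]_k) : 'rV[R]_k :=
  \sum_(0 <= i < n) a phi (psi_iter phi i eta).

(* Sequences are indexed by n >= 1 and families by t > 0: the values of B
   elsewhere are not used. *)
Definition limit_set_seq (T : topologicalType) (B : nat -> T) : set T :=
  [set gamma | exists n_ : nat -> nat,
    [/\ forall p, (0 < n_ p)%N, n_ p @[p --> \oo] --> \oo
      & B (n_ p) @[p --> \oo] --> gamma]].

Definition limit_set_fam (R : realType) (T : topologicalType) (B : R -> T) :
    set T :=
  [set gamma | exists t_ : nat -> R,
    [/\ forall p, 0 < t_ p, t_ p @[p --> \oo] --> +oo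
      & B (t_ p) @[p --> \oo] --> gamma]].

Definition Q (R : realType) (k : nat) (phi : R -> 'rV[R]_k -> 'rV[R]_k)
  (eta : 'rV[R]_k) : set 'rV[R]_k :=
  limit_set_seq (fun n => n%:R^-1 *: a_sum phi n eta).

(* Main.v *)
Require Import Defs.
From mathcomp Require Import all_boot all_order all_algebra.
From mathcomp Require Import all_classical all_reals all_analysis.

Import Order.TTheory GRing.Theory Num.Theory.
Import numFieldNormedType.Exports.

Local Open Scope classical_set_scope.
Local Open Scope ring_scope.

(** Two facts make the two limit sets agree. First, the displacement
    [phi s xi - xi] is bounded over all [s] in [[0, 1]] and all [xi]: it is
    invariant under integer translations of [xi], so its values are those it
    takes on the compact set [[0, 1] * [0, 1]^k], where it is continuous
    ([displacement_bounded]). Second, for [n <= t <= n + 1] the functional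
    equation gives [phi t eta = phi (t - n) (psi_n eta)], and telescoping gives
    [psi_n eta = eta + a_n eta]; hence [phi t eta] stays within a constant
    distance of [a_n eta] when [n] is the integer part of [t]
    ([solution_near_a_sum]).

    A bounded error disappears after division by a quantity tending to infinity
    ([cvg_scale_bounded_dist]). So a sequence [n_p] realising a vector of
    [Q phi eta] realises the same vector for the continuous family at
    [t_p = n_p], and a sequence of times [t_p] realises the same vector for
    [a_n / n] along the integer parts [n_p] of [t_p], because [t_p / n_p] tends
    to [1]. *)

Lemma cvg_scale_bounded_dist {R : realType} {V : normedModType R}
    {I : Type} {F : set_system I} {FF : Filter F} (u : I -> R) (v w : I -> V)
    (C : R) (g : V) :
  u @ F --> +oo -> (\forall i \near F, `|v i - w i| <= C) ->
  (u i)^-1 *: v i @[i --> F] --> g -> (u i)^-1 *: w i @[i --> F] --> g.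
Proof.
move=> uoo vwC vg.
have u0 : \forall i \near F, 0 < u i by move/cvgryPgt : uoo; exact.
have uV : (u i)^-1 @[i --> F] --> (0 : R) by apply/gtr0_cvgV0.
have err0 : (u i)^-1 *: (v i - w i) @[i --> F] --> (0 : V).
  apply/norm_cvg0P.
  have bnd0 : (u i)^-1 * C @[i --> F] --> (0 : R).
    by rewrite -(mul0r C); apply: cvgM => //; exact: cvg_cst.
  apply: (squeeze_cvgr _ (cvg_cst 0) bnd0).
  near=> i; rewrite normr_ge0/= normrZ gtr0_norm; last first.
    by rewrite invr_gt0; near: i.
  rewrite ler_wpM2l ?invr_ge0//; last by near: i.
  by apply: ltW; near: i.
have -> : (fun i => (u i)^-1 *: w i) =
          (fun i => (u i)^-1 *: v i - (u i)^-1 *: (v i - w i)).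
  by apply/funext => i; rewrite scalerBr subKr.
by rewrite -(subr0 g); apply: cvgB.
Unshelve. all: by end_near. Qed.

Lemma cvg_truncn {R : realType} {I : Type} {F : set_system I}
    {FF : Filter F} (u : I -> R) :
  u @ F --> +oo -> Num.truncn (u i) @[i --> F] --> \oo.
Proof.
move=> uoo; apply/cvgnyPge => N.
move/cvgryPge : uoo => /(_ N%:R); apply: filterS => i Nu.
by rewrite truncn_ge_nat// (le_trans _ Nu).
Qed.

(** By periodicity it is enough to bound the displacement on a fundamental
    domain for the integer translations, and the unit cube is compact. *)
Lemma displacement_bounded {R : realType} {k : nat}
    {phi : R -> 'rV[R]_k -> 'rV[R]_k}
    (phi_sol : generalised_solution phi) :
  exists M : R, forall s xi, 0 <= s <= 1 -> `|phi s xi - xi| <= M.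
Proof.
case: (phi_sol) => cont _ per _ _.
pose K : set (R * 'rV[R]_k) :=
  `[0, 1] `*` [set v : 'rV[R]_k | forall i, `[0, 1]%classic (v ord0 i)].
pose disp (p : R * 'rV[R]_k) := phi p.1 p.2 - p.2.
have cK : compact K.
  apply: compact_setX; first exact: segment_compact.
  apply: (@rV_compact R k (fun=> `[0, 1]%classic)) => _.
  exact: segment_compact.
have cont_disp : {within K, continuous disp}.
  move=> p; apply: cvgB.
    apply: (continuous_subspaceW _ cont) => -[s v] [/= + _].
    by rewrite in_itv/= => /andP[].
  by apply: continuous_subspaceT => q; exact: cvg_snd.
have [M [_ MP]] := compact_bounded (continuous_compact cont_disp cK).
exists (M + 1) => s xi s01; have /andP[s0 _] := s01.
pose q : 'rV[int]_k := map_mx Num.floor xi.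
pose y := xi - int_vec R q.
have -> : xi = y + int_vec R q by rewrite subrK.
rewrite per// opprD addrACA subrr addr0.
apply: (MP (M + 1)); first by rewrite ltrDl.
exists (s, y) => //; split => /=; first by rewrite in_itv.
move=> i; rewrite /= in_itv/= !mxE.
rewrite subr_ge0 floor_le_tmp/= lerBlDl ltW//.
by have := floorD1_gt (xi ord0 i); rewrite intrD.
Qed.

Lemma solution_addn {R : realType} {k : nat}
    {phi : R -> 'rV[R]_k -> 'rV[R]_k}
    (phi_sol : generalised_solution phi) n s eta :
  0 <= s -> phi (s + n%:R) eta = phi s (psi_iter phi n eta).
Proof.
case: (phi_sol) => _ _ _ _ step s0.
elim: n eta => [|n IH] eta; first by rewrite addr0.
by rewrite -natr1 addrA step ?addr_ge0// IH /psi_iter -iterSr.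
Qed.

Lemma psi_iter_a_sum {R : realType} {k : nat}
    (phi : R -> 'rV[R]_k -> 'rV[R]_k) n eta :
  psi_iter phi n eta = eta + a_sum phi n eta.
Proof. by rewrite /a_sum /a telescope_sumr// subrKC. Qed.

Lemma solution_near_a_sum {R : realType} {k : nat}
    {phi : R -> 'rV[R]_k -> 'rV[R]_k}
    (phi_sol : generalised_solution phi) eta :
  exists C : R, forall t, 0 <= t ->
    `|phi t eta - a_sum phi (Num.truncn t) eta| <= C.
Proof.
have [M MP] := displacement_bounded phi_sol.
(* [M] covers the fractional part of the time, and [eta] is the difference
   between [psi_n eta] and [a_n eta]. *)
exists (M + `|eta|) => t t0.
have /andP[nt tn] := truncn_itv t0.
set n := Num.truncn t in nt tn *.
have s0 : 0 <= t - n%:R by rewrite subr_ge0.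
rewrite -[X in phi X](subrK n%:R) (solution_addn phi_sol)//.
have -> : a_sum phi n eta = psi_iter phi n eta - eta.
  by rewrite psi_iter_a_sum addrAC subrr add0r.
rewrite opprB addrCA addrC (le_trans (ler_normD _ _))// lerD//.
by apply: MP; rewrite s0/= lerBlDr addrC natr1 ltW.
Qed.

Theorem theorem3p7 (R : realType) (k : nat) (k_ge1 : (1 <= k)%N)
    (phi : R -> 'rV[R]_k -> 'rV[R]_k) (phi_sol : generalised_solution phi)
    (eta : 'rV[R]_k) :
  limit_set_fam (fun t => t^-1 *: phi t eta) = Q phi eta.
Proof.
have [C CP] := solution_near_a_sum phi_sol eta.
apply/seteqP; split => gamma /=.
- move=> [t [t0 too tg]].
  (* The indices must be positive, so integer parts equal to 0 are replaced
     by 1; this concerns only finitely many p. *)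
  pose n p := maxn 1 (Num.truncn (t p)).
  have n_trunc : \forall p \near \oo, n p = Num.truncn (t p).
    have /cvgryPge/(_ 1) := too; apply: filterS => p t1.
    by rewrite /n; apply/maxn_idPr; rewrite truncn_ge_nat// ltW.
  have noo : n p @[p --> \oo] --> \oo.
    apply/cvgnyPge => N; have /cvg_truncn/cvgnyPge/(_ N) := too.
    by apply: filterS => p /leq_trans; apply; exact: leq_maxr.
  have nRoo : (n p)%:R @[p --> \oo] --> (+oo : set_system R).
    by apply: cvg_comp noo _; exact: cvgr_idn.
  exists n; split => //; first by move=> p; rewrite leq_max.
  have n0 p : (n p)%:R != 0 :> R by rewrite pnatr_eq0 -lt0n leq_max.
  (* [t p] is within 1 of [n p], and [n p / n p] is constantly 1. *)
  have ratio1 : (n p)%:R^-1 *: (t p : R^o) @[p --> \oo] --> (1 : R^o).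
    apply: (@cvg_scale_bounded_dist _ R^o _ _ _ (fun p => (n p)%:R)
      (fun p => (n p)%:R) t 1) => //.
    + near=> p; have -> : n p = Num.truncn (t p) by near: p.
      have /andP[nt tn] := truncn_itv (ltW (t0 p)).
      by rewrite distrC ger0_norm ?subr_ge0// lerBlDr addrC natr1 ltW.
    + rewrite (_ : (fun p => _) = fun=> 1); first exact: cvg_cst.
      by apply/funext => p; rewrite /GRing.scale/= mulVf.
  apply: (@cvg_scale_bounded_dist _ _ _ _ _ _ (fun p => phi (t p) eta) _ C) => //.
    near=> p; have -> : n p = Num.truncn (t p) by near: p.
    exact/CP/ltW.
  have -> : (fun p => (n p)%:R^-1 *: phi (t p) eta) =
            (fun p => ((n p)%:R^-1 * t p) *: ((t p)^-1 *: phi (t p) eta)).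
    by apply/funext => p; rewrite scalerA mulfK// gt_eqF.
  by rewrite -(scale1r gamma); apply: cvgZ.
- move=> [n [n0 noo ng]].
  have nRoo : (n p)%:R @[p --> \oo] --> (+oo : set_system R).
    by apply: cvg_comp noo _; exact: cvgr_idn.
  exists (fun p => (n p)%:R); split => //; first by move=> p; rewrite ltr0n.
  apply: (@cvg_scale_bounded_dist _ _ _ _ _ _ _ _ C _ _ _ ng) => //.
  apply: nearW => p; have := CP (n p)%:R (ler0n _ _).
  by rewrite natrK distrC.
Unshelve. all: by end_near. Qed.
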